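(* Let $H=(V,E)$ be a connected hypergraph with $|V|\ge 2$, in which every edge has cardinality at least $2$ and every vertex has degree at least $2$. Then the following are equivalent: (1) $H$ has no cut edges; (2) every pair of distinct elements from $V\cup E$ lie on a common strict closed trail; (3) every pair of distinct vertices lie on a common strict closed trail; (4) every pair of distinct edges lie on a common strict closed trail.
   Context: A hypergraph $H=(V,E)$ consists of a nonempty finite vertex set $V$, a finite edge set $E$, and an incidence function $\psi:E\to 2^V$; edges are identified with their vertex sets (parallel edges allowed); the degree of a vertex is the number of edges containing it. Two distinct vertices are adjacent via $e$ if both lie in $e$; a walk is a sequence $v_0e_1v_1\dots e_kv_k$ with $v_{i-1},v_i$ adjacent via $e_i$; $H$ is connected if any two distinct vertices are joined by a walk. A strict closed trail is a walk $v_0e_1v_1\dots e_kv_k$ with $k\ge2$, $v_0=v_k$, and the edges $e_1,\dots,e_k$ pairwise distinct (vertices may repeat); a vertex (edge) lies on it if it is one of the $v_i$ (one of the $e_i$). For an equivalence class $V'$ of ''joined by a walk'', the connected component is $(V',\{f\in E:\emptyset\ne f\subseteq V'\})$; $\omega(H)$ is the number of components. $H-e=(V,E\setminus\{e\})$; $e$ is a cut edge if $\omega(H-e)>\omega(H)$. *)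

(* Defs.v *)
From HB Require Import structures.
From mathcomp Require Import all_boot.

Set Implicit Arguments.
Unset Strict Implicit.
Unset Printing Implicit Defensive.

(* Distinct elements of [edge H] may have the same vertex set: parallel edges. *)
Record hypergraph := Hypergraph {
  vertex : finType;
  edge : finType;
  incidence : edge -> {set vertex};
  vertex_gt0 : 0 < #|vertex|
}.

Section Hypergraph.
Variable H : hypergraph.
Implicit Types (u v w : vertex H) (e f : edge H) (s : seq (edge H * vertex H)).

Definition degree v : nat := #|[set e | v \in incidence e]|.

Definition adjacent_via e u v : bool :=
  [&& u != v, u \in incidence e & v \in incidence e].

Definition adjacent u v : bool := [exists e, adjacent_via e u v].

(* The walk v_0 e_1 v_1 ... e_k v_k is given by its initial vertex v_0 and the *)
(* sequence of pairs (e_1, v_1), ..., (e_k, v_k), which may be empty.          *)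
Fixpoint walk u s : bool :=
  if s is (e, v) :: s' then adjacent_via e u v && walk v s' else true.

Definition walk_vertices u s : seq (vertex H) := u :: [seq p.2 | p <- s].
Definition walk_edges s : seq (edge H) := [seq p.1 | p <- s].
Definition walk_end u s : vertex H := last u [seq p.2 | p <- s].

Definition joined u v : Prop := exists s, walk u s /\ walk_end u s = v.

Definition connected : Prop := forall u v, u != v -> joined u v.

Lemma joinedP u v : reflect (joined u v) (connect adjacent u v).
Proof.
apply: (iffP connectP) => [[p]|[s []]].
  elim: p u => [|w p IHp] u /=; first by move=> _ ->; exists [::].
  case/andP=> /existsP[e uw] /IHp{}IHp /IHp[s [ws <-]].
  by exists ((e, w) :: s); rewrite /= uw.
elim: s u => [|[e w] s IHs] u /=; first by move=> _ <-; exists [::].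
case/andP=> uw /IHs{}IHs /IHs[p pw vp].
by exists (w :: p) => //=; rewrite pw andbT; apply/existsP; exists e.
Qed.

(* By [joinedP] the blocks below are the equivalence classes of [joined]. *)
Definition components : {set {set vertex H} * {set edge H}} :=
  [set (C, [set f : edge H | (incidence f != set0) && (incidence f \subset C)])
  | C : {set vertex H} in equivalence_partition (connect adjacent) [set: vertex H]].

Definition omega : nat := #|components|.

Definition strict_closed_trail u s : Prop :=
  [/\ walk u s, 2 <= size s, walk_end u s = u & uniq (walk_edges s)].

Definition lies_on (x : vertex H + edge H) u s : bool :=
  match x with
  | inl v => v \in walk_vertices u s
  | inr e => e \in walk_edges s
  end.

Definition on_common_strict_closed_trail (x y : vertex H + edge H) : Prop :=
  exists u s, [/\ strict_closed_trail u s, lies_on x u s & lies_on y u s].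

Definition delete_edge e : hypergraph :=
  @Hypergraph (vertex H) {f : edge H | f != e}
    (fun f : {f : edge H | f != e} => incidence (val f)) (vertex_gt0 H).

End Hypergraph.

Definition cut_edge (H : hypergraph) (e : edge H) : Prop :=
  omega H < omega (delete_edge e).

(* Main.v *)
Require Import Defs.
From HB Require Import structures.
From mathcomp Require Import all_boot.

Set Implicit Arguments.
Unset Strict Implicit.
Unset Printing Implicit Defensive.

(* The hypergraph is turned into a simple graph whose nodes are its edges and
   its flags (e, v) with v in e: an edge is linked to its flags, and two flags
   are linked when they share their vertex. If no edge of H is a cut edge, this
   graph has no cut vertex, so by Whitney any two of its nodes lie on a common
   cycle, and such a cycle reads as a strict closed trail of H. Conversely,
   deleting one edge from a strict closed trail leaves its vertices joined;
   when trails are only given for pairs of edges, one uses that every vertex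
   also lies in an edge other than the deleted one. *)

(** * Whitney's theorem: common cycles in graphs without cut vertices *)

Section CommonCycle.
Variables (T : finType) (r : rel T).
Hypothesis r_sym : symmetric r.

Definition avoiding z x y := [&& r x y, x != z & y != z].

(** The size bound excludes a single edge run back and forth, which [cycle] accepts for symmetric
    [r]. *)
Definition on_common_cycle a b :=
  exists c, [/\ cycle r c, uniq c, 2 < size c, a \in c & b \in c].

Lemma path_avoiding z a p : a != z ->
  path (avoiding z) a p = path r a p && (z \notin p).
Proof.
elim: p a => [|b p IHp] a az //=; rewrite {1}/avoiding inE negb_or az /=.
have [->|bz] := eqVneq b z; first by rewrite !andbF.
by rewrite IHp // andbT /= andbA.
Qed.

(* The ear d, q, z replaces the arc b, p1, z of the cycle. *)
Lemma on_common_cycle_ear a b d q z p1 p2 :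
    cycle r (b :: p1 ++ z :: p2) -> uniq (b :: p1 ++ z :: p2) ->
    path r b (d :: q ++ [:: z]) -> uniq (d :: q) ->
    ~~ has [in b :: p1 ++ z :: p2] (d :: q) -> a \in z :: p2 ->
  on_common_cycle a d.
Proof.
move=> cyc uc pq uq dis az; exists (b :: (d :: q) ++ z :: p2).
have sub x : x \in b :: z :: p2 -> x \in b :: p1 ++ z :: p2.
  by rewrite !(inE, mem_cat) => /or3P[]->; rewrite ?orbT.
split.
- move: cyc pq; rewrite /= !rcons_cat /= !cat_path /= !rcons_path.
  by case/and3P=> _ _ /andP[-> ->] /and4P[-> -> -> _].
- rewrite cons_uniq cat_uniq uq mem_cat negb_or.
  have -> : b \notin d :: q.
    by apply: contra dis => bq; apply/hasP; exists b; rewrite ?mem_head.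
  move: uc; rewrite cons_uniq cat_uniq mem_cat negb_or => /andP[/andP[_ ->]].
  case/and3P=> _ _ /= ->; rewrite andbT.
  apply: contra dis => /(@hasP _ _ (z :: p2))[x xz xq].
  apply/hasP; exists x => //.
  by apply: sub; rewrite inE xz orbT.
- by rewrite /= size_cat /= !addnS.
- by rewrite inE mem_cat az !orbT.
- by rewrite !inE eqxx orbT.
Qed.

(** A path from [d] to [a] avoiding [b] is followed up to its first node [z] on the cycle. Together
    with the edge from [b] to [d] it forms an ear, which replaces an arc between [b] and [z] that
    does not have [a] in its interior. *)
Lemma on_common_cycle_adj a b d :
    connect (avoiding b) d a -> a != b -> d != b -> r b d ->
  on_common_cycle a b -> on_common_cycle a d.
Proof.
move=> conn ab db rbd [c [cyc uc sc ac bc]].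
have [dc|dNc] := boolP (d \in c); first by exists c.
have [i p def_c] := rot_to bc.
move: cyc uc ac dNc; rewrite -(rot_cycle i) -(rot_uniq i).
rewrite -(mem_rot i c a) -(mem_rot i c d) def_c.
rewrite !inE (negPf ab) (negPf db) /= => cyc uc ap dp {c def_c sc bc i}.
case/connectP: conn => q0 /shortenP[q pq uq _] def_a {q0}.
have hasq : has [in p] q.
  apply/hasP; exists a => //; move: (mem_last d q); rewrite -def_a inE.
  by case/predU1P=> // ad; rewrite -ad ap in dp.
rewrite path_avoiding // in pq; case/andP: pq => pq bq.
case/split_find: hasq uq pq bq => z q1 q2 zp dis.
rewrite -cat_cons -rcons_cons cat_uniq rcons_uniq => /andP[/andP[_ uq1] _].
rewrite cat_path => /andP[pq1 _]; rewrite mem_cat mem_rcons inE !negb_or.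
case/andP=> /andP[bz bq1] _.
have {}pq1 : path r b (d :: q1 ++ [:: z]) by rewrite cats1 /= rbd.
case/splitPr: zp cyc uc ap dp dis => p1 p2 cyc uc ap dp dis.
have {dp}dis : ~~ has [in b :: p1 ++ z :: p2] (d :: q1).
  rewrite /= inE (negPf db) (negPf dp) /=.
  apply: contra dis => /hasP[x xq1 xb]; apply/hasP; exists x => //.
  by move: xb; rewrite inE => /predU1P[def_x|//]; rewrite -def_x xq1 in bq1.
have [az|az] := boolP (a \in z :: p2).
  exact: (@on_common_cycle_ear a b d q1 z p1 p2).
have ap1 : a \in p1 by move: ap; rewrite mem_cat (negPf az) orbF.
(* Otherwise [a] lies on the replaced arc: reverse the cycle. *)
have def_rev : b :: rev p2 ++ z :: rev p1 = rotr 1 (rev (b :: p1 ++ z :: p2)).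
  by rewrite rev_cons rotr1_rcons rev_cat rev_cons cat_rcons.
apply: (@on_common_cycle_ear a b d q1 z (rev p2) (rev p1)) => //.
- by rewrite def_rev rotr_cycle rev_cycle (eq_cycle (e' := r)).
- by rewrite def_rev rotr_uniq rev_uniq.
- by rewrite def_rev; under eq_has => x do rewrite /= mem_rotr mem_rev.
- by rewrite inE mem_rev ap1 orbT.
Qed.

Hypothesis card_gt2 : 2 < #|T|.
Hypothesis no_cut_vertex :
  forall z a b, a != z -> b != z -> connect (avoiding z) a b.

Lemma exists_third a b : exists w : T, (a != w) && (b != w).
Proof.
have /card_gt0P[w] : 0 < #|~: [set a; b]|.
  rewrite cardsCs setCK subn_gt0 cards2.
  by apply: leq_ltn_trans card_gt2; case: (a != b).
by rewrite !inE negb_or => /andP[wa wb]; exists w; rewrite eq_sym wa eq_sym.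
Qed.

(** The edge is no bridge: a third node [w] stays joined to [a] without [b] and to [b] without [a].
    This gives a second route from [a] to [b], which the edge closes to a cycle. *)
Lemma on_common_cycle_edge a b : a != b -> r a b -> on_common_cycle a b.
Proof.
move=> ab rab; have [w /andP[aw bw]] := exists_third a b.
(* Dropping the one direction from [a] to [b] is enough to keep the route from being that single
   step. *)
pose r' := [rel x y | r x y && ~~ ((x == a) && (y == b))].
have sub z : z \in [:: a; b] -> subrel (avoiding z) r'.
  rewrite !inE => zab x y /and3P[/= -> xz yz] /=.
  apply: contraTN zab => /andP[/eqP<- /eqP<-].
  by rewrite negb_or !(eq_sym z) xz.
have conn z x y : z \in [:: a; b] -> x != z -> y != z -> connect r' x y.
  move=> zab xz yz; apply: connect_sub (no_cut_vertex xz yz) => x' y'.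
  by move/(sub _ zab)/connect1.
have /connectP[p0] : connect r' a b.
  apply: (@connect_trans _ _ w).
    by apply: (conn b); rewrite ?inE ?eqxx ?orbT // eq_sym.
  by apply: (conn a); rewrite ?inE ?eqxx ?orbT // eq_sym.
case/shortenP=> p pp up _ def_b; exists (a :: p); split=> //.
- rewrite (@cycle_path _ a) /= -def_b r_sym rab /=.
  by apply: sub_path pp => x y /andP[].
- case: p pp up def_b => [|x [|//]] /=.
    by move=> _ _ E; rewrite E eqxx in ab.
  by move=> /andP[/andP[_]] + _ _ E; rewrite -E !eqxx.
- exact: mem_head.
- by rewrite def_b mem_last.
Qed.

(** Induction along a path starting at [a]: the common cycle is moved from each node to the next,
    and created from an edge when the path leaves [a]. *)
Theorem two_on_common_cycle a b : a != b -> on_common_cycle a b.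
Proof.
(* Deleting a third node [w] turns the hypothesis into a path from [a] to [b]. *)
have [w /andP[aw bw]] := exists_third a b; rewrite eq_sym.
case/connectP: (no_cut_vertex aw bw) => p pp -> {b bw}.
have {}pp : path r a p by move: pp; rewrite path_avoiding // => /andP[].
elim/last_ind: p pp => [|p d IHp]; first by rewrite eqxx.
rewrite rcons_path last_rcons => /andP[/IHp{}IHp rd da].
have [E|ba] := eqVneq (last a p) a.
  by rewrite E eq_sym in rd da; apply: on_common_cycle_edge; rewrite // eq_sym.
(* The step may be a loop, since [r] need not be irreflexive. *)
have [<-|db] := eqVneq (last a p) d; first exact: IHp.
have ab : a != last a p by rewrite eq_sym.
apply: on_common_cycle_adj ab _ rd (IHp ba); last by rewrite eq_sym.
by apply: no_cut_vertex; rewrite // eq_sym.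
Qed.

End CommonCycle.

(** * Components, cut edges and closed trails *)

Lemma omegaE (H : hypergraph) :
  omega H = #|[set [set v in [set: vertex H] | connect (@adjacent H) u v]
              | u in [set: vertex H]]|.
Proof. by apply: card_in_imset => ? ? _ _ []. Qed.

Lemma omega_gt0 (H : hypergraph) : 0 < omega H.
Proof.
have [v _] := card_gt0P (vertex_gt0 H).
by rewrite omegaE; apply/card_gt0P; eexists; apply: (imset_f _ (in_setT v)).
Qed.

Lemma omega_le1P (H : hypergraph) :
  reflect (forall u v, connect (@adjacent H) u v) (omega H <= 1).
Proof.
rewrite omegaE; apply: (iffP card_le1_eqP) => [le1 u v|conn B C].
  have /setP/(_ v) := le1 _ _ (imset_f _ (in_setT v)) (imset_f _ (in_setT u)).
  by rewrite !inE connect0.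
by move=> /imsetP[u _ ->] /imsetP[v _ ->]; apply/setP=> w; rewrite !inE !conn.
Qed.

Section Hypergraph.
Variable H : hypergraph.
Implicit Types (u v : vertex H) (e f g : edge H).

(** Phrased with the edges of [H] itself, so that walks of [H] apply without passing to the edge
    subtype of [delete_edge]. *)
Definition adjacent_avoiding e u v : bool :=
  [exists f, (f != e) && adjacent_via f u v].

Lemma adjacent_avoidingE e :
  adjacent_avoiding e =2 @adjacent (delete_edge e).
Proof.
move=> u v; apply/existsP/existsP => [[f /andP[fe uv]]|[f uv]].
  by exists (exist _ f fe).
by exists (val f); rewrite (valP f).
Qed.

Lemma adjacent_avoiding_sym e : symmetric (adjacent_avoiding e).
Proof.
move=> u v; apply: eq_existsb => f.
by rewrite /adjacent_via [u == v]eq_sym [(u \in _) && _]andbC.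
Qed.

Lemma walk_avoiding e u s v : walk u s -> e \notin walk_edges s ->
  v \in walk_vertices u s -> connect (adjacent_avoiding e) u v.
Proof.
elim: s u => [|[f w] s IHs] u; first by move=> _ _; rewrite inE => /eqP->.
rewrite /= inE negb_or => /andP[uw ws] /andP[ef es].
rewrite inE => /predU1P[->//|vs]; apply: connect_trans (IHs w ws es vs).
by apply/connect1/existsP; exists f; rewrite eq_sym ef.
Qed.

Lemma walk_cat u s1 s2 :
  walk u (s1 ++ s2) = walk u s1 && walk (walk_end u s1) s2.
Proof. by elim: s1 u => [|[e w] s1 IHs] u //=; rewrite IHs andbA. Qed.

(** The edge [e] occurs at most once. Cutting the trail there leaves two walks avoiding [e], one
    starting and one ending at [u], which together visit all its vertices. *)
Lemma closed_trail_avoiding e u s v : strict_closed_trail u s ->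
  v \in walk_vertices u s -> connect (adjacent_avoiding e) u v.
Proof.
case=> ws _ closed us; have [es|] := boolP (e \in walk_edges s); last first.
  exact: walk_avoiding.
case/mapP: es => -[f w] ews /= ef; rewrite -{f}ef in ews.
case/splitPr: ews ws us closed => s1 s2.
rewrite walk_cat /walk_edges map_cat cat_uniq /= => /and3P[ws1 _ ws2].
case/and4P=> _; rewrite negb_or => /andP[es1 _] es2 _.
rewrite /walk_end map_cat last_cat /= => closed.
have wu : connect (adjacent_avoiding e) u w.
  rewrite (sym_connect_sym (adjacent_avoiding_sym e)).
  by apply: (walk_avoiding ws2 es2); rewrite -[X in X \in _]closed mem_last.
rewrite /walk_vertices map_cat -cat_cons mem_cat => /orP[vs1|vs2].
  exact: walk_avoiding vs1.
exact: connect_trans wu (walk_avoiding ws2 es2 vs2).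
Qed.

(** Connectedness gives [omega H = 1], so [e] is no cut edge exactly when at most one component
    remains without it. *)
Lemma not_cut_edgeP e : connected H ->
  ~ cut_edge e <-> (forall u v, connect (adjacent_avoiding e) u v).
Proof.
move=> conn; have omega1 : omega H = 1.
  apply/eqP; rewrite eqn_leq omega_gt0 andbT; apply/omega_le1P => u v.
  by have [->|uv] := eqVneq u v; last exact/joinedP/conn.
rewrite /cut_edge omega1; split.
  move/negP; rewrite -leqNgt => /omega_le1P conne u v.
  by rewrite (eq_connect (adjacent_avoidingE e)).
move=> conne; apply/negP; rewrite -leqNgt; apply/omega_le1P => u v.
by rewrite -(eq_connect (adjacent_avoidingE e)).
Qed.

End Hypergraph.


(** * The flag graph *)

Section FlagGraph.
Variable H : hypergraph.
Implicit Types (u v : vertex H) (e f g : edge H).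

Definition flag := {i : edge H * vertex H | i.2 \in incidence i.1}.
Definition node : finType := (edge H + flag)%type.
Implicit Types (i j k : flag) (a b : node).

Definition flag_edge i : edge H := (val i).1.
Definition flag_vertex i : vertex H := (val i).2.
Definition Flag e v (ve : v \in incidence e) : flag := exist _ (e, v) ve.

(** Assigns every node to an edge, so that deleting a node can be compared with deleting its whole
    edge. *)
Definition node_edge a : edge H :=
  match a with inl e => e | inr i => flag_edge i end.

(* Each vertex of [H] is blown up into the clique of its flags, so that a cycle
   may visit it repeatedly. *)
Definition flag_adj : rel node := fun a b =>
  match a, b with
  | inl e, inr i | inr i, inl e => flag_edge i == e
  | inr i, inr j => flag_vertex i == flag_vertex j
  | inl _, inl _ => false
  end.

Lemma flag_adj_sym : symmetric flag_adj.
Proof. by case=> [e|i] [f|j] //=; rewrite eq_sym. Qed.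

Lemma flag_vertexP i : flag_vertex i \in incidence (flag_edge i).
Proof. exact: (valP i). Qed.

Lemma flag_inj i j :
  flag_edge i = flag_edge j -> flag_vertex i = flag_vertex j -> i = j.
Proof.
rewrite /flag_edge /flag_vertex => ef uv; apply: val_inj.
by rewrite [val i]surjective_pairing ef uv -surjective_pairing.
Qed.

(** * Absence of cut vertices in the flag graph *)

Section NoCutVertex.
Hypothesis noCut : forall e u v, connect (adjacent_avoiding e) u v.
Hypothesis card_edge : forall e, 2 <= #|incidence e|.
Hypothesis min_degree : forall v, 2 <= degree v.

Lemma other_edge e v : exists2 f, f != e & v \in incidence f.
Proof.
have /card_gt0P[f] : 0 < #|[set f | v \in incidence f] :\ e|.
  have := min_degree v; rewrite /degree (cardsD1 e).
  by case: (e \in _) => // /ltnW.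
by rewrite !inE => /andP[]; exists f.
Qed.

Lemma other_flag i : exists2 j, j != i & flag_edge j = flag_edge i.
Proof.
have /card_gt0P[v] : 0 < #|incidence (flag_edge i) :\ flag_vertex i|.
  have := card_edge (flag_edge i).
  by rewrite (cardsD1 (flag_vertex i)) flag_vertexP.
rewrite !inE => /andP[vi ve]; exists (Flag ve) => //.
by apply: contraNneq vi => <-.
Qed.

Lemma edge_flag e : exists i, flag_edge i = e.
Proof.
have /card_gt0P[v ve] := ltnW (card_edge e).
by exists (Flag ve).
Qed.

(** Removes [e] with all its flags, the counterpart of deleting [e] from [H]. *)
Definition off_edge e : rel node := fun a b =>
  [&& flag_adj a b, node_edge a != e & node_edge b != e].

Lemma off_edge_sym e : symmetric (off_edge e).
Proof. by move=> a b; rewrite /off_edge flag_adj_sym [(_ != e) && _]andbC. Qed.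

(** A step from [u] to [v] via [f] lifts to the nodes [(f, u)], [f], [(f, v)]; consecutive steps are
    linked inside the clique of flags at their common vertex. *)
Lemma off_edge_flags e i j : flag_edge i != e -> flag_edge j != e ->
  connect (off_edge e) (inr i) (inr j).
Proof.
move=> ie; case/connectP: (noCut e (flag_vertex i) (flag_vertex j)) => p.
elim: p i ie => [|v p IHp] i ie /=.
  by move=> _ ij je; apply: connect1; rewrite /off_edge /= ij eqxx ie.
case/andP=> /existsP[f /and4P[fe _ uf vf]] pp last_p je.
have step a b : flag_adj a b -> node_edge a != e -> node_edge b != e ->
  connect (off_edge e) a b by move=> ab ae be; apply/connect1/and3P.
apply: connect_trans (IHp (Flag vf) fe pp last_p je).
apply: (@connect_trans _ _ (inr (Flag uf))); first by apply: step => /=.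
by apply: (@connect_trans _ _ (inl f)); apply: step => /=.
Qed.

Lemma off_edge_connect e a b : node_edge a != e -> node_edge b != e ->
  connect (off_edge e) a b.
Proof.
have to_flag c : node_edge c != e ->
    exists2 i, flag_edge i != e & connect (off_edge e) c (inr i).
  case: c => [f|i] ce; last by exists i.
  have [i fi] := edge_flag f; exists i; first by rewrite fi.
  by apply/connect1; rewrite /off_edge /= fi eqxx ce.
move=> /to_flag[i ie ai] /to_flag[j je bj].
apply: connect_trans ai (connect_trans (off_edge_flags ie je) _).
by rewrite (sym_connect_sym (@off_edge_sym e)).
Qed.

(* Deleting an edge or one of its flags is handled at once: the other flags of
   the edge reach nodes off the edge through their vertex. *)
Lemma flag_graph_no_cut_vertex (z a b : node) : a != z -> b != z ->
  connect (avoiding flag_adj z) a b.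
Proof.
set R := avoiding _ z; set e := node_edge z.
have R_sym : symmetric R.
  by move=> x y; rewrite /R /avoiding flag_adj_sym [(_ != z) && _]andbC.
have flag_out i : inr i != z ->
    exists2 x, node_edge x != e & connect R (inr i) x.
  move=> iz; have [f fe vf] := other_edge e (flag_vertex i).
  exists (inr (Flag vf)) => //; apply/connect1/and3P; split=> //=.
  by apply: contraNneq fe => /= zE; rewrite /e -zE.
have out c : c != z -> exists2 x, node_edge x != e & connect R c x.
  case: c => [f fz|i]; last exact: flag_out.
  have [fe|fe] := eqVneq f e; last by exists (inl f).
  case def_z: z => [g|i]; first by case/eqP: fz; rewrite fe /e def_z.
  (* Here [c] is the edge of the deleted flag [i]; it escapes through another of its flags. *)
  have [j ji je] := other_flag i.
  have jz : inr j != z by rewrite def_z; apply: contraNneq ji => -[->].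
  have [x xe jx] := flag_out j jz; exists x => //.
  apply: connect_trans jx; apply/connect1/and3P; split=> //=.
  by rewrite fe /e def_z je.
move=> /out[x xe ax] /out[y ye byy]; apply: connect_trans ax _.
apply: (@connect_trans _ _ y); last by rewrite (sym_connect_sym R_sym).
(* As [z] belongs to [e], a path off [e] avoids [z]. *)
apply: connect_sub (off_edge_connect xe ye) => c d /and3P[cd ce de].
apply/connect1/and3P; split=> //.
  by apply: contraNneq ce => ->.
by apply: contraNneq de => ->.
Qed.

Lemma card_node_gt2 : 0 < #|vertex H| -> 2 < #|node|.
Proof.
case/card_gt0P=> v _; have /card_gt0P[e _] := ltnW (min_degree v).
have [i ie] := edge_flag e; have [j ji _] := other_flag i.
have uniq3 : uniq ([:: inl e; inr i; inr j] : seq node).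
  by rewrite /= !inE /= andbT; apply: contraNneq ji => -[->].
by apply: leq_trans (max_card [in [:: inl e; inr i; inr j]]);
  rewrite (card_uniqP uniq3).
Qed.

End NoCutVertex.

(** * From cycles of the flag graph to closed trails *)

Definition node_edges (p : seq node) : seq (edge H) :=
  pmap (fun a => if a is inl e then Some e else None) p.

Lemma mem_node_edges p e : (e \in node_edges p) = (inl e \in p).
Proof.
by elim: p => [|[f|i] p IHp] //=; rewrite !inE IHp.
Qed.

Lemma uniq_node_edges p : uniq p -> uniq (node_edges p).
Proof.
elim: p => [|[f|i] p IHp] //= /andP[fp /IHp] //.
by rewrite mem_node_edges fp.
Qed.

(** A move between flags stays at the same vertex, and a passage flag, edge, flag is one step of the
    walk. The latter consumes two nodes, hence the induction on a bound for the size. *)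
Lemma walk_of_flag_path i j p : path flag_adj (inr i) p -> uniq (inr i :: p) ->
    last (inr i : node) p = inr j ->
  exists s, [/\ walk (flag_vertex i) s,
    walk_end (flag_vertex i) s = flag_vertex j, walk_edges s = node_edges p &
    forall k, inr k \in (inr i : node) :: p ->
      flag_vertex k \in walk_vertices (flag_vertex i) s].
Proof.
have [n le_n] := ubnP (size p); elim: n => // n IHn in i p le_n *.
case: p le_n => [|[e|k] p] le_n.
- move=> _ _ [<-]; exists [::]; split=> // k.
  by rewrite !inE => /eqP[->].
- case: p le_n => [|[f|k] p] le_n; rewrite //= ?andbF //.
  move=> /and3P[/eqP ie /eqP ke pp] /and3P[iNp _ up] lp.
  have [|//|//|//|s [ws es Es Vs]] := IHn k p.
    exact: (ltnW (le_n : (size p).+2 <= n)).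
  exists ((e, flag_vertex k) :: s); split=> //=; last 2 first.
  + by rewrite /walk_edges /= -/(walk_edges s) Es.
  + move=> l; rewrite inE => /predU1P[[->]|]; first exact: mem_head.
    by rewrite inE => /predU1P[//|/Vs lp']; rewrite inE orbC lp'.
  rewrite ws andbT /adjacent_via -{1}ie -{1}ke !flag_vertexP /= andbT.
  (* Two flags of [e] at the same vertex coincide, but the path repeats no node. *)
  apply: contraNneq iNp => ik; rewrite !inE /=.
  by rewrite (@flag_inj i k) ?eqxx // ie.
- rewrite /= => /andP[/eqP ik pp] /andP[_ up] lp.
  have [//|//|//|//|s [ws es Es Vs]] := IHn k p.
  exists s; rewrite ik; split=> // l; rewrite inE => /predU1P[[->]|/Vs//].
  by rewrite ik mem_head.
Qed.

(** Edges are not linked to each other, so the cycle can be rotated to start at a flag [i]. If it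
    ends in an edge, one more step along that edge returns to the vertex of [i]; if it ends in a
    flag, the walk is already closed. *)
Lemma closed_trail_of_flag_cycle c : cycle flag_adj c -> uniq c -> 2 < size c ->
  exists u s, [/\ walk u s, walk_end u s = u, uniq (walk_edges s),
    {subset node_edges c <= walk_edges s} &
    forall i, inr i \in c -> flag_vertex i \in walk_vertices u s].
Proof.
move=> cyc uc sc.
have [i ic] : exists i, inr i \in c.
  case: c cyc sc {uc} => [|[e|i] [|[f|j] c]] // _ _.
  - by exists j; rewrite !inE eqxx orbT.
  - by exists i; rewrite mem_head.
  - by exists i; rewrite mem_head.
have [n p def_c] := rot_to ic.
have mem_c : c =i inr i :: p by move=> a; rewrite -def_c mem_rot.
have {sc} sc : 2 < size (inr i :: p) by rewrite -def_c size_rot.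
move: cyc uc; rewrite -(rot_cycle n) -(rot_uniq n) def_c => cyc uc.
have cE e : (e \in node_edges c) = (e \in node_edges p).
  by rewrite !mem_node_edges mem_c inE.
have up : uniq p by case/andP: uc.
move: cyc; rewrite /= rcons_path => /andP[pp]; case def_l: (last _ p) => [e|j].
  case/lastP: p => [|p a] in uc sc mem_c cE up pp def_l {def_c} *; first by [].
  rewrite last_rcons in def_l; rewrite {a}def_l in uc sc mem_c cE up pp.
  move: pp; rewrite rcons_path.
  case def_l: (last _ p) => [f|j] /andP[] // pp je ie.
  have up' : uniq (inr i :: p).
    by move: uc; rewrite -rcons_cons rcons_uniq => /andP[].
  have [s [ws es Es Vs]] := walk_of_flag_path pp up' def_l.
  have E :
      walk_edges (rcons s (e, flag_vertex i)) = node_edges (rcons p (inl e)).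
    rewrite /walk_edges map_rcons -/(walk_edges s) Es.
    by rewrite /node_edges -!cats1 pmap_cat.
  exists (flag_vertex i), (rcons s (e, flag_vertex i)); split.
  - rewrite -cats1 walk_cat ws es /= andbT /adjacent_via.
    rewrite -{1}(eqP je) -(eqP ie) !flag_vertexP !andbT.
    (* Equal vertices would force [i = j], leaving a cycle of only two nodes, [i] and [e]. *)
    apply: contraTneq sc => ji; have ij : i = j.
      by apply: flag_inj; rewrite // (eqP ie) (eqP je).
    case: p def_l up' {pp uc mem_c cE up E Es Vs} => [|a p] //= def_l.
    by rewrite ij -def_l mem_last.
  - by rewrite /walk_end map_rcons last_rcons.
  - by rewrite E uniq_node_edges.
  - by move=> f; rewrite cE E.
  - move=> k; rewrite mem_c -rcons_cons mem_rcons inE => /Vs.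
    rewrite /walk_vertices map_rcons -rcons_cons [in X in _ -> X]mem_rcons inE.
    by move=> ->; rewrite orbT.
move=> /= ij; have [s [ws es Es Vs]] := walk_of_flag_path pp uc def_l.
exists (flag_vertex i), s; split=> //.
- by rewrite es (eqP ij).
- by rewrite Es uniq_node_edges.
- by move=> e; rewrite cE Es.
- by move=> k; rewrite mem_c => /Vs.
Qed.

Lemma common_closed_trail :
    (forall e u v, connect (adjacent_avoiding e) u v) ->
    (forall e, 2 <= #|incidence e|) -> (forall v, 2 <= degree v) ->
  forall x y : vertex H + edge H, x != y -> on_common_strict_closed_trail x y.
Proof.
move=> noCut card_edge min_degree x y xy.
(* An edge is represented by its own node, a vertex by any of its flags. *)
pose repr (x : vertex H + edge H) a :=
  match x, a with
  | inl v, inr i => flag_vertex i = v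
  | inr e, inl f => e = f
  | _, _ => False
  end.
have reprP x' : exists a, repr x' a.
  case: x' => [v|e]; last by exists (inl e).
  have /card_gt0P[e] := ltnW (min_degree v); rewrite inE => ve.
  by exists (inr (Flag ve)).
have [[a xa] [b yb]] := (reprP x, reprP y).
have ab : a != b.
  apply: contra_neq xy => ab; move: xa yb; rewrite ab.
  by case: x y b {ab} => [u|e] [v|f] [g|i] //= -> ->.
have [c [cyc uc sc ac bc]] := two_on_common_cycle flag_adj_sym
  (card_node_gt2 card_edge min_degree (vertex_gt0 H))
  (flag_graph_no_cut_vertex noCut card_edge min_degree) ab.
have [u [s [ws closed us Es Vs]]] := closed_trail_of_flag_cycle cyc uc sc.
have on_trail x' a' : repr x' a' -> a' \in c -> lies_on x' u s.
  case: x' a' => [v|e] [f|i] //= => [<-|->]; first exact: Vs.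
  by rewrite -mem_node_edges; apply: Es.
have xs := on_trail _ _ xa ac; have ys := on_trail _ _ yb bc.
exists u, s; split=> //; split=> //.
(* An empty walk carries no two distinct elements, and a single step cannot close up because
   adjacent vertices differ. *)
case: s ws closed xs ys {us Es Vs on_trail} => [|[e v] [|//]] /=.
  move=> _ _; case: x y xy {xa yb} => [v|//] [w|//] vw /=.
  by rewrite !inE => /eqP vu /eqP wu; rewrite vu wu eqxx in vw.
by rewrite /walk_end /= => /andP[/and3P[uv _ _] _] vu; rewrite vu eqxx in uv.
Qed.

End FlagGraph.

(** * The equivalences *)

Theorem theorem3p47 (H : hypergraph)
  (connH : connected H)
  (cardV : 2 <= #|vertex H|)
  (card_edge : forall e : edge H, 2 <= #|incidence e|)
  (min_degree : forall v : vertex H, 2 <= degree v) :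
  [<-> forall e : edge H, ~ cut_edge e;
       forall x y : vertex H + edge H,
         x != y -> on_common_strict_closed_trail x y;
       forall u v : vertex H,
         u != v -> on_common_strict_closed_trail (inl u) (inl v);
       forall e f : edge H,
         e != f -> on_common_strict_closed_trail (inr e) (inr f)].
Proof.
have trail_connect (e : edge H) w s u v : strict_closed_trail w s ->
    u \in walk_vertices w s -> v \in walk_vertices w s ->
    connect (adjacent_avoiding e) u v.
  move=> sT us vs; apply: connect_trans (closed_trail_avoiding e sT vs).
  rewrite (sym_connect_sym (@adjacent_avoiding_sym H e)).
  exact: closed_trail_avoiding sT us.
have noCut_trails : (forall e : edge H, ~ cut_edge e) ->
    forall x y : vertex H + edge H,
      x != y -> on_common_strict_closed_trail x y.
  move=> noCut; apply: common_closed_trail => // e.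
  exact/not_cut_edgeP.
tfae=> // [trails u v uv|trails e f ef|trails e].
- by apply: trails.
(* Trails through pairs of vertices rule out cut edges, and trails through pairs of edges then
   follow from the flag graph. *)
- apply: noCut_trails => // {e f ef} e; apply/not_cut_edgeP => // u v.
  have [->|/trails[w [s [sT us vs]]]] := eqVneq u v; first exact: connect0.
  exact: trail_connect sT us vs.
- apply/not_cut_edgeP => // u v.
  (* The route from [u] to [v] leaves along [f], follows a trail common to [f] and [g], and arrives
     along [g]. *)
  have [f fe uf] := other_edge min_degree e u.
  have [g ge vg] := other_edge min_degree e v.
  have in_edge (h : edge H) x y : h != e -> x \in incidence h ->
      y \in incidence h -> connect (adjacent_avoiding e) x y.
    move=> he xh yh; have [->|xy] := eqVneq x y; first exact: connect0.
    by apply/connect1/existsP; exists h; rewrite he /=; apply/and3P.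
  have [fg|/trails[w [s [sT fs gs]]]] := eqVneq f g.
    by rewrite -fg in vg; apply: (in_edge f).
  have edge_vertex h : h \in walk_edges s ->
      exists2 x, x \in walk_vertices w s & x \in incidence h.
    case: sT => ws _ _ _; elim: s w ws {fs gs} => //= -[h' x] s IHs w.
    case/andP=> /and3P[_ _ xh'] /IHs{}IHs; rewrite inE => /predU1P[->|/IHs].
      by exists x; rewrite // !inE eqxx orbT.
    by case=> y ys yh; exists y; rewrite // inE ys orbT.
  have [x xs xf] := edge_vertex f fs; have [y ys yg] := edge_vertex g gs.
  apply: connect_trans (in_edge f u x fe uf xf) _.
  apply: connect_trans (trail_connect e w s x y sT xs ys) _.
  exact: (in_edge g).
Qed.
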